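(* Let $F$ be a scalar group, let $V$ be a near-vector space over $F$, and let $W\subseteq V$. Then $W$ is an $F$-subspace of $V$ if and only if $W$ is a near-vector space over $F$ with the same operations as $V$.
   Context: A scalar group is a tuple $F=(F,\cdot,1,0,-1)$ where $(F,\cdot,1)$ is a monoid, $0,-1\in F$, $0\cdot\alpha=0=\alpha\cdot 0$ for all $\alpha\in F$, $\{1,-1\}$ is the solution set of the equation $x^2=1$ in $F$, and $(F\setminus\{0\},\cdot,1)$ is a group. An $F$-space is an abelian group $(V,+)$ with a map $F\times V\to V$, $(\alpha,v)\mapsto\alpha\cdot v$, such that for all $\alpha,\beta\in F$, $v,w\in V$: $\alpha\cdot(\beta\cdot v)=(\alpha\cdot\beta)\cdot v$, $1\cdot v=v$, $\alpha\cdot(v+w)=\alpha\cdot v+\alpha\cdot w$, $(-1)\cdot v=-v$, $0\cdot v=0$. The quasi-kernel of an $F$-space $V$ is $Q(V)=\{v\in V\mid \forall \alpha,\beta\in F\ \exists\gamma\in F:\ \alpha\cdot v+\beta\cdot v=\gamma\cdot v\}$. A near-vector space over $F$ is an $F$-space $V$ whose action is free (if $\alpha\cdot v=\beta\cdot v$ then $v=0$ or $\alpha=\beta$) and such that $Q(V)$ generates $V$ as an additive group. An $F$-subspace of $V$ is a nonempty subset of $V$ closed under addition and scalar multiplication. *)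

(* Defs.v *)
From HB Require Import structures.
From mathcomp Require Import all_boot all_algebra.
From mathcomp Require Import boolp classical_sets.

Set Implicit Arguments.
Unset Strict Implicit.
Unset Printing Implicit Defensive.

Local Open Scope classical_set_scope.
Local Open Scope ring_scope.

(* The last three axioms say that F \ {0} is a group under the monoid law; 1 and
   -1 may coincide. *)
HB.mixin Record Monoid_isScalarGroup F of Monoid F := {
  szero : F;
  sminus1 : F;
  smul0x : forall a : F, (szero * a)%g = szero;
  smulx0 : forall a : F, (a * szero)%g = szero;
  ssqr_eq1 : forall a : F, (a * a)%g = 1%g <-> a = 1%g \/ a = sminus1;
  sone_neq0 : (1%g : F) <> szero;
  smul_neq0 : forall a b : F, a <> szero -> b <> szero -> (a * b)%g <> szero;
  sinv_ex : forall a : F, a <> szero ->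
    exists b : F, [/\ b <> szero, (b * a)%g = 1%g & (a * b)%g = 1%g]
}.

#[short(type="scalarGroupType")]
HB.structure Definition ScalarGroup := {F of Monoid_isScalarGroup F & Monoid F}.

HB.mixin Record Zmodule_isFSpace (F : scalarGroupType) V of GRing.Zmodule V := {
  act : F -> V -> V;
  actA : forall (a b : F) (v : V), act a (act b v) = act (a * b)%g v;
  act1 : forall v : V, act 1%g v = v;
  actD : forall (a : F) (v w : V), act a (v + w) = act a v + act a w;
  actN1 : forall v : V, act sminus1 v = - v;
  act0 : forall v : V, act szero v = 0
}.

#[short(type="fspaceType")]
HB.structure Definition FSpace (F : scalarGroupType) :=
  {V of Zmodule_isFSpace F V & GRing.Zmodule V}.

Notation "a *:: v" := (act a v) (at level 40, left associativity) : ring_scope.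

Definition quasi_kernel (F : scalarGroupType) (V : fspaceType F) : set V :=
  [set v | forall a b : F, exists c : F, a *:: v + b *:: v = c *:: v].

Definition additive_span (V : zmodType) (A : set V) : set V :=
  smallest [set B : set V | zmod_closed (mem B)] A.

HB.mixin Record FSpace_isNearVectorSpace (F : scalarGroupType) V
    of FSpace F V := {
  act_free : forall (a b : F) (v : V), a *:: v = b *:: v -> v = 0 \/ a = b;
  quasi_kernel_gen : additive_span (@quasi_kernel F V) = setT
}.

#[short(type="nearVectorSpaceType")]
HB.structure Definition NearVectorSpace (F : scalarGroupType) :=
  {V of FSpace_isNearVectorSpace F V & FSpace F V}.

Definition is_Fsubspace (F : scalarGroupType) (V : fspaceType F) (W : set V)
    : Prop :=
  [/\ W !=set0,
      forall v w : V, W v -> W w -> W (v + w)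
    & forall (a : F) (v : V), W v -> W (a *:: v)].

(* A [NearVectorSpace.axioms_ F W] is a near-vector space structure whose carrier
   is the subset W itself (coerced to the type [set_type W]). *)
Definition is_near_vector_space_with_ops_of (F : scalarGroupType)
    (V : fspaceType F) (W : set V) : Prop :=
  exists s : NearVectorSpace.axioms_ F W,
    let U : nearVectorSpaceType F := NearVectorSpace.Pack s in
    let incl : U -> V := fun u : W => \val u in
    (forall v w : U, incl (v + w) = incl v + incl w) /\
    (forall (a : F) (v : U), incl (a *:: v) = a *:: incl v).

(* Main.v *)
(** Let [W] be a subspace of [V] and let [v = q1 + q2 + ...] in [W] be a sum of
    [n] elements of the quasi-kernel. If [a q1 + b q1 = c q1] always implies
    [a q2 + b q2 = c q2], then [q1 + q2] is in the quasi-kernel and [v] is a sum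
    of [n - 1] such elements. Otherwise some operator
    [g x = e^-1 (a x + b x - c x)] kills [q1], fixes [q2], preserves [W], and maps
    each quasi-kernel element to one of its scalar multiples; then [g v] and
    [v - g v] are both in [W] and sums of [n - 1] quasi-kernel elements. Hence, by
    induction on [n], [W] is generated by the quasi-kernel elements in [W]. *)
Require Import Defs.
From HB Require Import structures.
From mathcomp Require Import all_boot all_algebra.
From mathcomp Require Import boolp classical_sets.

Set Implicit Arguments.
Unset Strict Implicit.
Unset Printing Implicit Defensive.

Import GRing.Theory.
Local Open Scope classical_set_scope.
Local Open Scope ring_scope.

Lemma additive_span_zmod_closed (V : zmodType) (A : set V) :
  zmod_closed (mem (additive_span A)).
Proof.
split=> [|x y xA yA]; rewrite inE => B [Bclosed AB].
  by have [B0 _] := Bclosed; move: B0; rewrite inE.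
have [_ BB] := Bclosed; rewrite !inE in xA yA.
have := BB x y; rewrite !inE; apply; [exact: xA | exact: yA].
Qed.

Lemma additive_span0 (V : zmodType) (A : set V) : additive_span A 0.
Proof. by have [] := additive_span_zmod_closed A; rewrite inE. Qed.

Lemma additive_spanD (V : zmodType) (A : set V) (x y : V) :
  additive_span A x -> additive_span A y -> additive_span A (x + y).
Proof.
move=> xA yA; have [_ AB] := additive_span_zmod_closed A.
(* Closure is stated for subtraction only, so [x + y] is obtained as [x - (0 - y)]. *)
have Ny := AB 0 y; have D := AB x (- y); rewrite opprK sub0r !inE in D Ny.
by apply: D => //; apply: Ny => //; apply: additive_span0.
Qed.

Lemma is_Fsubspace0 (F : scalarGroupType) (V : fspaceType F) (W : set V) :
  is_Fsubspace W -> W 0.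
Proof. by case=> -[w Ww] _ WZ; rewrite -(act0 w); apply: WZ. Qed.

Lemma is_FsubspaceN (F : scalarGroupType) (V : fspaceType F) (W : set V)
    (v : V) :
  is_Fsubspace W -> W v -> W (- v).
Proof. by case=> _ _ WZ Wv; rewrite -actN1; apply: WZ. Qed.

Section QuasiKernel.
Variables (F : scalarGroupType) (V : fspaceType F).
Implicit Types (a b c : F) (q v w : V).

Lemma actx0 a : a *:: (0 : V) = 0.
Proof. by apply: (addIr (a *:: 0)); rewrite -actD !add0r. Qed.

Lemma actN a v : a *:: (- v) = - (a *:: v).
Proof. by apply/eqP; rewrite -addr_eq0 -actD addNr actx0. Qed.

Lemma act_opp a v : - (a *:: v) = (sminus1 * a)%g *:: v.
Proof. by rewrite -actA actN1. Qed.

Lemma quasi_kernel_act a q :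
  quasi_kernel q -> quasi_kernel (a *:: q).
Proof.
move=> Qq; have [->|a_neq0] := pselect (a = szero).
  by rewrite act0 => b c; exists b; rewrite !actx0 addr0.
(* Scalars need not commute: on [q] the pair becomes [b * a] and [c * a], and writing [d] as
   [(d * a') * a] turns the result back into a multiple of [a *:: q]. *)
move=> b c; have [d dE] := Qq (b * a)%g (c * a)%g.
have [a' [_ a'a _]] := sinv_ex a a_neq0.
by exists (d * a')%g; rewrite !actA dE -mulgA a'a mulg1.
Qed.

Lemma quasi_kernelB q a b :
  quasi_kernel q -> exists c, a *:: q - b *:: q = c *:: q.
Proof. by rewrite act_opp; apply. Qed.

(** The quasi-kernel is stable under [sminus1], so signs are absorbed into the summands and unsigned
    sums already form a subgroup. *)
Lemma additive_span_quasi_kernel_sum v :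
  additive_span (@quasi_kernel F V) v ->
  exists2 s : seq V, (forall q, q \in s -> quasi_kernel q) & v = \sum_(q <- s) q.
Proof.
apply: (@smallest_sub _ _ _ [set v | exists2 s : seq V,
  (forall q, q \in s -> quasi_kernel q) & v = \sum_(q <- s) q]); last first.
  move=> q Qq; exists [:: q] => [p|]; last by rewrite big_seq1.
  by rewrite inE => /eqP->.
split; first by rewrite inE; exists [::] => //; rewrite big_nil.
move=> x y; rewrite !inE => -[s sQ ->] [t tQ ->].
exists (s ++ [seq sminus1 *:: q | q <- t]) => [q|].
  by rewrite mem_cat => /orP[/sQ//|/mapP[p /tQ pQ ->]]; apply: quasi_kernel_act.
rewrite big_cat big_map; congr (_ + _); rewrite -sumrN.
by apply: eq_bigr => q _; rewrite actN1.
Qed.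

Lemma quasi_kernelD_or_separate q1 q2 :
  quasi_kernel q1 -> quasi_kernel q2 ->
  quasi_kernel (q1 + q2) \/
  exists a b c, a *:: q1 + b *:: q1 = c *:: q1 /\
                a *:: q2 + b *:: q2 <> c *:: q2.
Proof.
move=> Q1 Q2; have [|nsep] := pselect (exists a b c,
  a *:: q1 + b *:: q1 = c *:: q1 /\ a *:: q2 + b *:: q2 <> c *:: q2).
  by right.
left=> a b; have [c c1] := Q1 a b; exists c.
rewrite !actD addrACA c1; congr (_ + _).
by apply: contrapT => c2; apply: nsep; exists a, b, c.
Qed.

Lemma separating_operator q1 q2 (W : set V) :
  is_Fsubspace W -> quasi_kernel q1 -> quasi_kernel q2 ->
  quasi_kernel (q1 + q2) \/
  exists g : V -> V, [/\ {morph g : x y / x + y}, g 0 = 0, g q1 = 0 /\ g q2 = q2,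
    forall q, quasi_kernel q -> exists a, g q = a *:: q
    & forall w, W w -> W (g w)].
Proof.
move=> Wsub Q1 Q2; have [?|[a [b [c [c1 c2]]]]] := quasi_kernelD_or_separate Q1 Q2.
  by left.
right.
have comb q : quasi_kernel q ->
    exists e, a *:: q + b *:: q - c *:: q = e *:: q.
  by move=> Qq; have [d ->] := Qq a b; apply: quasi_kernelB.
have [e eE] := comb _ Q2.
(* [e] is the factor by which the combination scales [q2]. It is nonzero because the relation fails
   at [q2], and dividing by it makes [q2] fixed. *)
have e_neq0 : e <> szero.
  by move=> e0; apply: c2; apply/eqP; rewrite -subr_eq0 eE e0 act0.
have [e' [_ e'e _]] := sinv_ex e e_neq0.
exists (fun x => e' *:: (a *:: x + b *:: x - c *:: x)); split.
- move=> x y; rewrite -[RHS]actD; apply: (congr1 (act e')).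
  by rewrite !actD (addrACA (a *:: x)) opprD [LHS]addrACA.
- by rewrite !actx0 subr0 addr0 actx0.
- by rewrite c1 subrr actx0 eE actA e'e act1.
- by move=> q /comb[d ->]; exists (e' * d)%g; rewrite actA.
- move=> w Ww; have [_ WD WZ] := Wsub.
  apply: (WZ); apply: (WD); first by apply: (WD); apply: (WZ).
  by apply: (is_FsubspaceN Wsub); apply: (WZ).
Qed.

Lemma Fsubspace_sum_quasi_kernel (W : set V) (s : seq V) :
  is_Fsubspace W -> (forall q, q \in s -> quasi_kernel q) ->
  W (\sum_(q <- s) q) ->
  additive_span (@quasi_kernel F V `&` W) (\sum_(q <- s) q).
Proof.
move=> Wsub; move sizes: (size s) => n.
elim: n s sizes => [|n IHn] [|q1 s] //= sizes sQ.
  by move=> _; rewrite big_nil; apply: additive_span0.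
have Q1 : quasi_kernel q1 by apply: sQ; rewrite mem_head.
case: s sizes sQ => [|q2 s] [sizes] sQ.
  by rewrite big_seq1 => W1; apply: sub_gen_smallest.
have Q2 : quasi_kernel q2 by apply: sQ; rewrite !inE eqxx orbT.
have {}sQ q : q \in s -> quasi_kernel q.
  by move=> qs; apply: sQ; rewrite !inE qs !orbT.
(* The list [p :: map h s] is one shorter than the original, so each case below only has to choose
   [p] and [h]. *)
have IH p (h : V -> V) : quasi_kernel p ->
    (forall q, quasi_kernel q -> quasi_kernel (h q)) ->
    W (p + \sum_(q <- s) h q) ->
    additive_span (@quasi_kernel F V `&` W) (p + \sum_(q <- s) h q).
  move=> Qp Qh; have := IHn (p :: map h s).
  rewrite big_cons big_map; apply; first by rewrite /= size_map.
  by move=> q; rewrite inE => /orP[/eqP->//|/mapP[r /sQ/Qh ? ->]].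
rewrite !big_cons; set v := q1 + _ => Wv.
have [Q12|[g [gD g0 [g1 g2] gQ gW]]] := separating_operator Wsub Q1 Q2.
  (* [q1 + q2] now counts as a single summand. *)
  by rewrite /v addrA in Wv *; apply: (IH _ id).
(* Each of [g v] and [v - g v] loses one of the two leading terms. *)
have gvE : g v = q2 + \sum_(q <- s) g q.
  by rewrite /v !gD g1 add0r g2 (big_morph g gD g0).
have vgvE : v - g v = q1 + \sum_(q <- s) (q - g q).
  by rewrite gvE /v sumrB -addrA opprD addrACA subrr add0r.
rewrite -(subrK (g v) v); apply: additive_spanD.
  rewrite vgvE; apply: IH => //.
    (* Both [q] and [g q] are multiples of [q], hence so is their difference. *)
    move=> q Qq; have [a ->] := gQ q Qq; rewrite -[X in X - _]act1.
    by have [b ->] := quasi_kernelB 1%g a Qq; apply: quasi_kernel_act.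
  rewrite -vgvE; have [_ WD _] := Wsub; apply: WD => //.
  by apply: (is_FsubspaceN Wsub); apply: gW.
rewrite gvE; apply: IH => //; last by rewrite -gvE; apply: gW.
by move=> q Qq; have [a ->] := gQ q Qq; apply: quasi_kernel_act.
Qed.

End QuasiKernel.

(** Generation of [V] decomposes each element of [W], but into summands possibly outside [W]; the
    preceding induction repairs this. *)
Lemma Fsubspace_additive_span (F : scalarGroupType)
    (V : nearVectorSpaceType F) (W : set V) :
  is_Fsubspace W -> W `<=` additive_span (@quasi_kernel F V `&` W).
Proof.
move=> Wsub w Ww.
have : additive_span (@quasi_kernel F V) w by rewrite quasi_kernel_gen.
move=> /additive_span_quasi_kernel_sum[s sQ wE].
by rewrite wE in Ww *; apply: Fsubspace_sum_quasi_kernel.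
Qed.

(** The alias carries the subspace proof as a parameter, so that canonical structures on it can draw
    closure of the operations from that proof. *)
Definition subspace_type (F : scalarGroupType) (V : nearVectorSpaceType F)
  (W : set V) of is_Fsubspace W : Type := W.

Section SubspaceType.
Variables (F : scalarGroupType) (V : nearVectorSpaceType F) (W : set V).
Variable Wsub : is_Fsubspace W.
Local Notation T := (subspace_type Wsub).
Let incl (u : T) : V := \val (u : set_type W).
Let pack v (Wv : W v) : T := exist _ v (mem_set Wv).

Let incl_inj : injective incl. Proof. exact: val_inj. Qed.

Let inclP (u : T) : W (incl u). Proof. exact/set_mem/(valP (u : set_type W)). Qed.

HB.instance Definition _ := Choice.copy T (set_type W).

Let zero : T := pack (is_Fsubspace0 Wsub).
Let opp (u : T) : T := pack (is_FsubspaceN Wsub (inclP u)).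
Let add (u v : T) : T :=
  pack (let: And3 _ WD _ := Wsub in WD _ _ (inclP u) (inclP v)).
Let scale (a : F) (u : T) : T :=
  pack (let: And3 _ _ WZ := Wsub in WZ a _ (inclP u)).

Let addA : associative add.
Proof. by move=> x y z; apply/incl_inj/addrA. Qed.
Let addC : commutative add.
Proof. by move=> x y; apply/incl_inj/addrC. Qed.
Let add0 : left_id zero add.
Proof. by move=> x; apply/incl_inj/add0r. Qed.
Let addN : left_inverse zero opp add.
Proof. by move=> x; apply/incl_inj/addNr. Qed.

HB.instance Definition _ := GRing.isZmodule.Build T addA addC add0 addN.

Let scaleA a b (v : T) : scale a (scale b v) = scale (a * b)%g v.
Proof. exact/incl_inj/actA. Qed.
Let scale1 (v : T) : scale 1%g v = v.
Proof. exact/incl_inj/act1. Qed.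
Let scaleD a (v w : T) : scale a (v + w) = scale a v + scale a w.
Proof. exact/incl_inj/actD. Qed.
Let scaleN1 (v : T) : scale sminus1 v = - v.
Proof. exact/incl_inj/actN1. Qed.
Let scale0 (v : T) : scale szero v = 0.
Proof. exact/incl_inj/act0. Qed.

HB.instance Definition _ :=
  Zmodule_isFSpace.Build F T scaleA scale1 scaleD scaleN1 scale0.

Let scale_free (a b : F) (v : T) : a *:: v = b *:: v -> v = 0 \/ a = b.
Proof.
move=> /(congr1 incl) /(@act_free F V)[v0|]; last by right.
by left; apply: incl_inj.
Qed.

Let quasi_kernel_incl (u : T) :
  (@quasi_kernel F V) (incl u) -> quasi_kernel u.
Proof. by move=> Qu a b; have [c cE] := Qu a b; exists c; apply: incl_inj. Qed.

Let span_quasi_kernel : additive_span (@quasi_kernel F T) = setT.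
Proof.
apply/seteqP; split=> // u _ B [[B0 BB] QB].
(* The image of [B] in [V] is a subgroup containing the quasi-kernel elements of [W], hence all of
   [W]; injectivity of [incl] then returns [u] to [B]. *)
suff: [set v | exists2 w : T, incl w = v & B w] (incl u).
  by case=> w /incl_inj->.
apply: (Fsubspace_additive_span Wsub (inclP u)); split.
  split=> [|x y]; rewrite !inE.
    by exists 0 => //; move: B0; rewrite inE.
  move=> [x' <- Bx] [y' <- By]; exists (x' - y') => //.
  by have := BB x' y'; rewrite !inE; apply.
by move=> v [Qv Wv]; exists (pack Wv) => //; apply: QB; apply: quasi_kernel_incl.
Qed.

HB.instance Definition _ :=
  FSpace_isNearVectorSpace.Build F T scale_free span_quasi_kernel.

Lemma Fsubspace_near_vector_space : is_near_vector_space_with_ops_of W.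
(* [T] unfolds to [W] and its operations come from those of [V], so compatibility holds by
   computation. *)
Proof. by exists (NearVectorSpace.class (T : nearVectorSpaceType F)). Qed.

End SubspaceType.

Theorem theorem4p1 (F : scalarGroupType) (V : nearVectorSpaceType F)
    (W : set V) :
  is_Fsubspace W <-> is_near_vector_space_with_ops_of W.
Proof.
split=> [|[s [inclD inclZ]]]; first exact: Fsubspace_near_vector_space.
pose U : nearVectorSpaceType F := NearVectorSpace.Pack s.
pose pack v (Wv : W v) : U := exist _ v (mem_set Wv).
have inclP (u : U) : W (\val (u : set_type W)).
  exact/set_mem/(valP (u : set_type W)).
split.
(* Elements of [U] lie in [W] by typing: its zero gives nonemptiness, and compatibility identifies
   sums and multiples in [V] with included elements of [U]. *)
- by exists (\val ((0 : U) : set_type W)).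
- by move=> v w Wv Ww; rewrite -[v + w](inclD (pack v Wv) (pack w Ww)).
- by move=> a v Wv; rewrite -[a *:: v](inclZ a (pack v Wv)).
Qed.
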